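(* If $\mathsf{Kt}2\vdash A$ then $\mathfrak{R}\models A$ for every relational model $\mathfrak{R}$.
   Context: Formulas: $A ::= P \mid X \mid A\to B \mid \Box A \mid \blacksquare A \mid \forall X A$, with $\bot := \forall XX$, $\neg A := A\to\bot$, $\Diamond A := \forall X(\Box(A\to\blacksquare X)\to X)$, backward diamond $\Diamond^{\bullet}A := \forall X(\blacksquare(A\to\Box X)\to X)$. $\mathsf{IKt}2$: second-order intuitionistic propositional logic (with full comprehension $\forall XA\to A[C/X]$, modus ponens, generalisation with fresh propositional symbol), distribution axioms for $\Box,\Diamond,\blacksquare,\Diamond^{\bullet}$ (namely $\Box(A\to B)\to\Box A\to\Box B$, $\Box(A\to B)\to\Diamond A\to\Diamond B$, $\blacksquare(A\to B)\to\blacksquare A\to\blacksquare B$, $\blacksquare(A\to B)\to\Diamond^{\bullet}A\to\Diamond^{\bullet}B$), necessitation for $\Box$ and $\blacksquare$, and tense axioms $\Diamond^{\bullet}\Box A\to A$, $A\to\Box\Diamond^{\bullet}A$, $\Diamond\blacksquare A\to A$, $A\to\blacksquare\Diamond A$. $\mathsf{Kt}2 := \mathsf{IKt}2+(\neg\neg A\to A)$. A relational model: set $W$ of worlds, class $\mathcal{W}\subseteq\mathcal{P}(W)$ of sets, interpretations $P_{\mathfrak{R}}\in\mathcal{W}$, relation $R\subseteq W\times W$; classical satisfaction ($v\models A\to B$ iff $v\models A$ implies $v\models B$; $v\models\Box A$ iff $w\models A$ for all $vRw$; $v\models\blacksquare A$ iff $u\models A$ for all $uRv$; $v\models\forall XA$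 iff $v\models A[V/X]$ for all $V\in\mathcal{W}$; $v\models P$ iff $v\in P_{\mathfrak{R}}$), and comprehensive: $\{w: w\models C\}\in\mathcal{W}$ for every closed formula $C$ (with sets treated as symbols interpreted by themselves). $\mathfrak{R}\models A$ means every world satisfies $A$. *)

(* Defs.v *)
From mathcomp Require Import all_boot.
From mathcomp Require Import all_classical.

Set Implicit Arguments.
Unset Strict Implicit.
Unset Printing Implicit Defensive.

(* Formulas up to renaming of bound variables: propositional variables are de
   Bruijn indices, [All] binding index 0.  Propositional symbols, which are
   never bound, form a separate countable supply. *)
Inductive form : Type :=
| Sym (P : nat)
| Var (X : nat)
| Imp (A B : form)
| Box (A : form)
| BBox (A : form)
| All (A : form).

Definition scons (T : Type) (x : T) (f : nat -> T) (n : nat) : T :=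
  if n is m.+1 then f m else x.

Fixpoint rename (r : nat -> nat) (A : form) : form :=
  match A with
  | Sym P => Sym P
  | Var X => Var (r X)
  | Imp A B => Imp (rename r A) (rename r B)
  | Box A => Box (rename r A)
  | BBox A => BBox (rename r A)
  | All A => All (rename (scons 0 (fun n => (r n).+1)) A)
  end.

(* [shift A] is [A] seen under one more quantifier, whose variable is
   therefore not free in it. *)
Definition shift : form -> form := rename S.

Fixpoint subst (s : nat -> form) (A : form) : form :=
  match A with
  | Sym P => Sym P
  | Var X => s X
  | Imp A B => Imp (subst s A) (subst s B)
  | Box A => Box (subst s A)
  | BBox A => BBox (subst s A)
  | All A => All (subst (scons (Var 0) (fun n => shift (s n))) A)
  end.

(* A[C/X], where [A] is the body of a quantifier [All A] binding X. *)
Definition inst (A C : form) : form := subst (scons C Var) A.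

Fixpoint fresh (P : nat) (A : form) : Prop :=
  match A with
  | Sym Q => P <> Q
  | Var _ => True
  | Imp A B => fresh P A /\ fresh P B
  | Box A | BBox A | All A => fresh P A
  end.

Definition Bot : form := All (Var 0).
Definition Neg (A : form) : form := Imp A Bot.
Definition Dia (A : form) : form :=
  All (Imp (Box (Imp (shift A) (BBox (Var 0)))) (Var 0)).
Definition BDia (A : form) : form :=
  All (Imp (BBox (Imp (shift A) (Box (Var 0)))) (Var 0)).

(* Theorems of IKt2 extended by the additional axioms [Ax]. *)
Inductive IKt2_plus (Ax : form -> Prop) : form -> Prop :=
| ax_extra A : Ax A -> IKt2_plus Ax A
| ax_K A B : IKt2_plus Ax (Imp A (Imp B A))
| ax_S A B C : IKt2_plus Ax
    (Imp (Imp A (Imp B C)) (Imp (Imp A B) (Imp A C)))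
| ax_comprehension A C : IKt2_plus Ax (Imp (All A) (inst A C))
| ax_all_imp A B : IKt2_plus Ax
    (Imp (All (Imp (shift A) B)) (Imp A (All B)))
| ax_box_imp A B : IKt2_plus Ax (Imp (Box (Imp A B)) (Imp (Box A) (Box B)))
| ax_dia_imp A B : IKt2_plus Ax (Imp (Box (Imp A B)) (Imp (Dia A) (Dia B)))
| ax_bbox_imp A B : IKt2_plus Ax
    (Imp (BBox (Imp A B)) (Imp (BBox A) (BBox B)))
| ax_bdia_imp A B : IKt2_plus Ax
    (Imp (BBox (Imp A B)) (Imp (BDia A) (BDia B)))
| ax_bdia_box A : IKt2_plus Ax (Imp (BDia (Box A)) A)
| ax_box_bdia A : IKt2_plus Ax (Imp A (Box (BDia A)))
| ax_dia_bbox A : IKt2_plus Ax (Imp (Dia (BBox A)) A)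
| ax_bbox_dia A : IKt2_plus Ax (Imp A (BBox (Dia A)))
| rule_mp A B : IKt2_plus Ax (Imp A B) -> IKt2_plus Ax A -> IKt2_plus Ax B
| rule_gen A P : fresh P A -> IKt2_plus Ax (inst A (Sym P)) ->
    IKt2_plus Ax (All A)
| rule_nec_box A : IKt2_plus Ax A -> IKt2_plus Ax (Box A)
| rule_nec_bbox A : IKt2_plus Ax A -> IKt2_plus Ax (BBox A).

Definition IKt2 : form -> Prop := IKt2_plus (fun _ => False).

Definition Kt2 : form -> Prop :=
  IKt2_plus (fun F => exists A, F = Imp (Neg (Neg A)) A).

Record structure : Type := Structure {
  world : Type;
  sets : set (set world);
  interp : nat -> set world;
  interp_sets : forall P, sets (interp P);
  acc : world -> world -> Prop
}.

Arguments sets : clear implicits.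
Arguments interp : clear implicits.
Arguments acc : clear implicits.

(* A closed formula with sets as additional symbols is represented by a
   formula together with an assignment [rho] of these sets to its free
   variables, so that A[V/X] is [A] with [V] assigned to index 0. *)
Fixpoint sat (M : structure) (rho : nat -> set (world M)) (v : world M)
    (A : form) : Prop :=
  match A with
  | Sym P => interp M P v
  | Var X => rho X v
  | Imp A B => sat rho v A -> sat rho v B
  | Box A => forall w, acc M v w -> sat rho w A
  | BBox A => forall u, acc M u v -> sat rho u A
  | All A => forall V, sets M V -> sat (scons V rho) v A
  end.

Definition assignment (M : structure) (rho : nat -> set (world M)) : Prop :=
  forall X, sets M (rho X).

Definition comprehensive (M : structure) : Prop :=
  forall (C : form) (rho : nat -> set (world M)), assignment rho ->
    sets M [set w | sat rho w C]%classic.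

Record model : Type := Model {
  model_structure :> structure;
  model_comprehensive : comprehensive model_structure
}.

(* For closed [A] the assignment is immaterial; one always exists, since
   [sets M] contains the interpretations of the symbols. *)
Definition valid (M : model) (A : form) : Prop :=
  forall rho : nat -> set (world M), assignment rho ->
  forall v : world M, sat rho v A.

(* Main.v *)
(* Soundness is by induction on derivations, for all models at once.  Falsity
   [forall X, X] may hold at a world of a model with few sets, but
   comprehension makes every formula true there, so double negation
   elimination is still valid.  For generalisation on [P], the quantified
   variable is given the value [V] by reinterpreting [P] as [V]; the resulting
   structure is still comprehensive because [P] can be traded for a variable. *)
Require Import Defs.
From mathcomp Require Import all_boot.
From mathcomp Require Import all_classical.

Set Implicit Arguments.
Unset Strict Implicit.
Unset Printing Implicit Defensive.

Local Open Scope classical_set_scope.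

Lemma assignment_scons (M : structure) (V : set (world M))
    (rho : nat -> set (world M)) :
  sets M V -> assignment rho -> assignment (scons V rho).
Proof. by move=> hV hrho [|X] //=; exact: hrho. Qed.

Lemma scons_comp_rename (T : Type) (x : T) (f : nat -> T) (r : nat -> nat) :
  scons x f \o scons 0 (fun n => (r n).+1) = scons x (f \o r).
Proof. by apply/funext => -[|X]. Qed.

Lemma sat_rename (M : structure) (r : nat -> nat) (A : form)
    (rho : nat -> set (world M)) (v : world M) :
  sat rho v (rename r A) = sat (rho \o r) v A.
Proof.
elim: A r rho v => //= [A IHA B IHB|A IHA|A IHA|A IHA] r rho v.
- by rewrite IHA IHB.
- by apply: eq_forall => w; rewrite IHA.
- by apply: eq_forall => w; rewrite IHA.
- by apply: eq_forall => V; rewrite IHA scons_comp_rename.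
Qed.

Lemma sat_shift (M : structure) (A : form) (V : set (world M))
    (rho : nat -> set (world M)) (v : world M) :
  sat (scons V rho) v (shift A) = sat rho v A.
Proof. exact: sat_rename. Qed.

Lemma sat_subst (M : structure) (s : nat -> form) (A : form)
    (rho : nat -> set (world M)) (v : world M) :
  sat rho v (subst s A) = sat (fun X => [set w | sat rho w (s X)]) v A.
Proof.
elim: A s rho v => //= [A IHA B IHB|A IHA|A IHA|A IHA] s rho v.
- by rewrite IHA IHB.
- by apply: eq_forall => w; rewrite IHA.
- by apply: eq_forall => w; rewrite IHA.
- apply: eq_forall => V; rewrite IHA; congr (_ -> sat _ _ _).
  (* Index 0 has value [V] on both sides; at [X.+1] the shifted [s X] ignores [V]. *)
  by apply/funext => -[|X] //=; apply/funext => w; rewrite /= sat_shift.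
Qed.

Lemma sat_inst (M : structure) (A C : form)
    (rho : nat -> set (world M)) (v : world M) :
  sat rho v (inst A C) = sat (scons [set w | sat rho w C] rho) v A.
Proof.
by rewrite /inst sat_subst; congr (sat _ _ _); apply/funext => -[|X].
Qed.

(** The set defined by [A] is itself an admissible value of the variable bound in [Bot]. *)
Lemma sat_Bot (M : structure) (A : form) (rho : nat -> set (world M))
    (v : world M) :
  comprehensive M -> assignment rho -> sat rho v Bot -> sat rho v A.
Proof. by move=> hM hrho /(_ _ (hM A rho hrho)). Qed.

Section Reinterpretation.
Variables (M : structure) (P : nat) (V : set (world M)) (hV : sets M V).

Lemma reinterp_sets (Q : nat) :
  sets M (if Q == P then V else interp M Q).
Proof. by case: ifP => // _; exact: interp_sets. Qed.

Definition reinterp : structure :=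
  Structure reinterp_sets (acc M).

Lemma sat_reinterp_fresh (A : form) (rho : nat -> set (world M))
    (v : world M) :
  fresh P A -> @sat reinterp rho v A = sat rho v A.
Proof.
elim: A rho v => //= [Q|A IHA B IHB|A IHA|A IHA|A IHA] rho v.
- by move=> /eqP; rewrite eq_sym => /negPf ->.
- by move=> [fA fB]; rewrite IHA// IHB.
- by move=> fA; apply: eq_forall => w; rewrite IHA.
- by move=> fA; apply: eq_forall => w; rewrite IHA.
- by move=> fA; apply: eq_forall => U; rewrite IHA.
Qed.

(* [A] with its variables renamed by [r] and [P] replaced by variable [k]. *)
Fixpoint sym_to_var (k : nat) (r : nat -> nat) (A : form) : form :=
  match A with
  | Sym Q => if Q == P then Var k else Sym Q
  | Var X => Var (r X)
  | Imp A B => Imp (sym_to_var k r A) (sym_to_var k r B)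
  | Box A => Box (sym_to_var k r A)
  | BBox A => BBox (sym_to_var k r A)
  | All A => All (sym_to_var k.+1 (scons 0 (fun n => (r n).+1)) A)
  end.

(** Each quantifier raises [k] and lifts [r], so the induction runs over all [k], [r] and [rho]. *)
Lemma sat_sym_to_var (k : nat) (r : nat -> nat) (A : form)
    (rho : nat -> set (world M)) (v : world M) :
  rho k = V -> sat rho v (sym_to_var k r A) = @sat reinterp (rho \o r) v A.
Proof.
elim: A k r rho v => //= [Q|A IHA B IHB|A IHA|A IHA|A IHA] k r rho v rhok.
- by case: ifP => //= _; rewrite rhok.
- by rewrite IHA// IHB.
- by apply: eq_forall => w; rewrite IHA.
- by apply: eq_forall => w; rewrite IHA.
- by apply: eq_forall => U; rewrite IHA// scons_comp_rename.
Qed.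

Lemma comprehensive_reinterp : comprehensive M -> comprehensive reinterp.
Proof.
move=> hM C rho hrho /=.
(* Variable 0 carries [V] in place of [P]; renaming by [S] makes room for it, as [scons V rho \o S]
   is [rho]. *)
have := hM (sym_to_var 0 S C) _ (assignment_scons hV hrho).
by congr (sets M _); apply/funext => w /=; rewrite sat_sym_to_var.
Qed.

End Reinterpretation.

Lemma valid_gen (A : form) (P : nat) :
  fresh P A -> (forall M : model, valid M (inst A (Sym P))) ->
  forall M : model, valid M (All A).
Proof.
move=> fA hA M rho hrho v V hV.
have := hA (Model (@comprehensive_reinterp M P V hV (@model_comprehensive M))) rho
  hrho v.
(* Variable 0 now has as value the set defined by [Sym P], which is [V] after reinterpretation;
   freshness of [P] brings [A] back to [M]. *)
by rewrite sat_inst sat_reinterp_fresh //= eqxx.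
Qed.

Theorem theorem3p13 (A : form) (hA : Kt2 A) (M : model) : valid M A.
Proof.
elim: hA M => {A}.
- move=> _ [A ->] M rho hrho v /= nnA.
  (* If [A] fails at [v], then [Neg A] holds there vacuously, so [nnA] yields [Bot]. *)
  have [//|nA] := pselect (sat rho v A).
  apply: sat_Bot => //; first exact: model_comprehensive.
  by apply: nnA => /nA.
- by move=> A B M rho _ v /= hA _.
- by move=> A B C M rho _ v /= hABC hAB hA; apply: hABC => //; exact: hAB.
- move=> A C M rho hrho v /= hA; rewrite sat_inst.
  by apply: hA; exact: model_comprehensive.
- by move=> A B M rho _ v /= hAB hA V hV; apply: hAB => //; rewrite sat_shift.
- by move=> A B M rho _ v /= hAB hA w vw; apply: hAB => //; exact: hA.
- move=> A B M rho _ v /= hAB hA V hV hB; apply: hA => // w vw.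
  by rewrite sat_shift => /(hAB w vw) Bw; apply: hB => //; rewrite sat_shift.
- by move=> A B M rho _ v /= hAB hA w vw; apply: hAB => //; exact: hA.
- move=> A B M rho _ v /= hAB hA V hV hB; apply: hA => // w vw.
  by rewrite sat_shift => /(hAB w vw) Bw; apply: hB => //; rewrite sat_shift.
- move=> A M rho hrho v /= hA; have := @model_comprehensive M A rho hrho.
  by move=> /hA; apply=> u _ hu w /hu; rewrite -/(shift A) sat_shift.
- move=> A M rho _ v /= hA w vw V hV /(_ v vw); apply=> //.
  by rewrite sat_shift.
- move=> A M rho hrho v /= hA; have := @model_comprehensive M A rho hrho.
  by move=> /hA; apply=> u _ hu w /hu; rewrite -/(shift A) sat_shift.
- move=> A M rho _ v /= hA w vw V hV /(_ v vw); apply=> //.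
  by rewrite sat_shift.
- by move=> A B _ hAB _ hA M rho hrho v; apply: hAB => //; exact: hA.
- by move=> A P fA _ hA; exact: valid_gen hA.
- by move=> A _ hA M rho hrho v w _; exact: hA.
- by move=> A _ hA M rho hrho v w _; exact: hA.
Qed.
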